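(* Let $z_1,z_2,z_3,q$ be complex numbers with $|q|<1$. Define $P(m)$ for integers $m\ge 0$ by $$P(0)=1,\qquad P(1)=z_1+z_2+z_3,\qquad P(2)=q(z_1+z_2+z_3)^2+(1-q)(z_1z_2+z_2z_3+z_3z_1),$$ and, for $m\ge 3$, $$P(m)=q^{m-3}\Big((z_1+z_2+z_3)\,q^2P(m-1)+(z_1z_2+z_2z_3+z_3z_1)\,q(1-q^{m-1})P(m-2)+z_1z_2z_3(1-q^{m-2})(1-q^{m-1})P(m-3)\Big).$$ Then $$\prod_{m=1}^{\infty}(1+z_1q^m)(1+z_2q^m)(1+z_3q^m)=\sum_{m=0}^{\infty}\frac{q^mP(m)}{(1-q)(1-q^2)(1-q^3)\cdots(1-q^m)}.$$
   Context: The empty product (denominator for $m=0$) equals $1$, and $0^0=1$. *)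

(* Defs.v *)
From Stdlib Require Import Reals.
From Coquelicot Require Import Coquelicot.

Open Scope C_scope.

(* [Cprod f n] is f 1 * f 2 * ... * f n; in particular [Cprod f 0 = 1]. *)
Fixpoint Cprod (f : nat -> C) (n : nat) : C :=
  match n with
  | O => 1
  | S n' => Cprod f n' * f n
  end.

(* In the last branch m >= 3 and [m1], [m2], [m3] are m-1, m-2, m-3; they are
   named only to make the recursion structural.  The exponents use natural
   number subtraction, which is never truncated here. *)
Fixpoint P (z1 z2 z3 q : C) (m : nat) : C :=
  match m with
  | 0 => 1
  | 1 => z1 + z2 + z3
  | 2 => q * (z1 + z2 + z3) ^ 2 + (1 - q) * (z1 * z2 + z2 * z3 + z3 * z1)
  | S (S (S m3 as m2) as m1) =>
      q ^ (m - 3) *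
      ((z1 + z2 + z3) * q ^ 2 * P z1 z2 z3 q m1
       + (z1 * z2 + z2 * z3 + z3 * z1) * q * (1 - q ^ (m - 1))
         * P z1 z2 z3 q m2
       + z1 * z2 * z3 * (1 - q ^ (m - 2)) * (1 - q ^ (m - 1))
         * P z1 z2 z3 q m3)
  end.

(* Convergence is part of the assertion.  As usual for identities between
   infinite products and series, a product with zero factors is allowed (its
   value is then 0): the value is the limit of the partial products. *)
Definition is_Cinfprod (f : nat -> C) (l : C) : Prop :=
  filterlim (Cprod f) eventually (locally l).

(* Main.v *)
Require Import Defs.
From Stdlib Require Import Reals Lra.
From Coquelicot Require Import Coquelicot.

(** The series is Euler's expansion, for three factors, of
    [F(x) = prod_(m>=1) (1+z1 x q^m)(1+z2 x q^m)(1+z3 x q^m)] evaluated at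
    [x = 1].  Write [e1, e2, e3] for the elementary symmetric functions of the
    [z]'s.  Comparing coefficients in the functional equation
    [F(x) = (1 + e1 (q x) + e2 (q x)^2 + e3 (q x)^3) F(q x)] shows that the
    coefficients [c n] of [F] must satisfy
    [c n (1 - q^n) = q^n (e1 c (n-1) + e2 c (n-2) + e3 c (n-3))], and
    substituting [c n = q^n P n / ((1-q)...(1-q^n))] turns this into the
    recurrence defining [P] ([term_satisfies]).

    The proof runs this backwards, so that the product never has to be expanded.
    Any solution [c] of the recurrence with [c 0 = 1] is absolutely summable
    ([satisfies_summable]), because its coefficients carry the factor [q^n].
    Hence [G x = sum_n c n x^n] exists for [|x| <= 1] and satisfies the
    functional equation ([functional_equation]).  Iterating that equation gives
    [G 1 = (product of the first N factors) * G (q^N)], and [G (q^N)] tends to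
    [c 0 = 1].  So the partial products converge, with limit [G 1]; this also
    covers the case of a vanishing factor, since no division by the partial
    products takes place. *)

Open Scope C_scope.

(** * Summability from a recurrence with geometric weights *)

(** The sum of three consecutive terms grows at step [n] at most by the factor
    [1 + K r^n <= exp (K r^n)], and the product of these factors over all [n]
    is finite.  So the terms are bounded, and the recurrence then makes them
    geometrically small. *)
Lemma geometric_recurrence_summable (u : nat -> R) (K r : R) :
  (0 <= r < 1)%R -> (0 <= K)%R -> (forall n, 0 <= u n)%R ->
  (forall n, u (3 + n)%nat <= K * r ^ n * (u n + u (1 + n)%nat + u (2 + n)%nat))%R ->
  ex_series u.
Proof.
intros Hr HK Hu Hrec.
pose (b n := (u n + u (1 + n)%nat + u (2 + n)%nat)%R).
assert (Hb : forall n, (0 <= b n)%R).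
{ intros n; unfold b.
  generalize (Hu n) (Hu (1 + n)%nat) (Hu (2 + n)%nat); lra. }
assert (Hbound : forall n, (b n <= b 0%nat * exp (K * ((1 - r ^ n) / (1 - r))))%R).
{ induction n as [|n IH].
  - simpl pow; replace (K * ((1 - 1) / (1 - r)))%R with 0%R by (field; lra).
    rewrite exp_0; lra.
  - assert (Hstep : (b (S n) <= b n * exp (K * r ^ n))%R).
    { apply Rle_trans with (b n * (1 + K * r ^ n))%R.
      - generalize (Hrec n) (Hu n); unfold b; simpl; nra.
      - apply Rmult_le_compat_l; [apply Hb | apply exp_ineq1_le]. }
    apply Rle_trans with (1 := Hstep).
    replace (K * ((1 - r ^ S n) / (1 - r)))%R
      with (K * ((1 - r ^ n) / (1 - r)) + K * r ^ n)%R by (simpl; field; lra).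
    rewrite exp_plus, <- Rmult_assoc.
    apply Rmult_le_compat_r; [left; apply exp_pos | exact IH]. }
set (B := (b 0%nat * exp (K / (1 - r)))%R).
assert (HB : forall n, (b n <= B)%R).
{ intros n; apply Rle_trans with (1 := Hbound n).
  apply Rmult_le_compat_l; [apply Hb|].
  assert (He : (K * ((1 - r ^ n) / (1 - r)) <= K / (1 - r))%R).
  { unfold Rdiv; apply Rmult_le_compat_l; [exact HK|].
    rewrite <- (Rmult_1_l (/ (1 - r))) at 2.
    apply Rmult_le_compat_r; [left; apply Rinv_0_lt_compat; lra|].
    generalize (pow_le r n); lra. }
  destruct He as [He | He]; [left; apply exp_increasing, He | rewrite He; lra]. }
do 3 apply ex_series_incr_1.
apply (ex_series_le (V := R_CompleteNormedModule) _ (fun n => (K * B) * r ^ n)%R).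
- intros n; change (norm ?x) with (Rabs x); rewrite Rabs_pos_eq by apply Hu.
  apply Rle_trans with (1 := Hrec n).
  change (u n + u (1 + n)%nat + u (2 + n)%nat)%R with (b n).
  generalize (HB n) (pow_le r n (proj1 Hr)); intros H1 H2.
  replace (K * B * r ^ n)%R with (K * r ^ n * B)%R by ring.
  apply Rmult_le_compat_l; [nra | exact H1].
- apply (ex_series_scal (V := R_NormedModule) (K * B)%R).
  apply ex_series_geom; rewrite Rabs_pos_eq; lra.
Qed.

(** * Power series solutions of the functional equation *)

(** Multiplication of a power series by its variable; the leading [0] takes the
    place of the coefficients of negative index. *)
Definition shift (a : nat -> C) (n : nat) : C :=
  match n with O => 0 | S m => a m end.

Definition satisfies (e1 e2 e3 q : C) (c : nat -> C) : Prop :=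
  forall n, c n * (1 - q ^ n) =
    q ^ n * (e1 * shift c n + e2 * shift (shift c) n
             + e3 * shift (shift (shift c)) n).

Lemma is_series_shift (a : nat -> C) (l : C) :
  is_series a l -> is_series (shift a) l.
Proof.
intros H; apply is_series_decr_1; simpl.
match goal with |- is_series _ ?t => replace t with l end; [exact H|].
change (l = l + - 0); ring.
Qed.

(** Termwise, the recurrence says that the coefficient [c n x^n] equals
    [c n y^n + e1 y (c (n-1) y^(n-1)) + ...] with [y = q x]. *)
Lemma functional_equation (e1 e2 e3 q : C) (c : nat -> C) (x g : C) :
  satisfies e1 e2 e3 q c ->
  is_series (fun n => c n * (q * x) ^ n) g ->
  is_series (fun n => c n * x ^ n)
    ((1 + e1 * (q * x) + e2 * (q * x) ^ 2 + e3 * (q * x) ^ 3) * g).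
Proof.
intros Hc Hg; set (y := q * x) in *.
set (a := fun n => c n * y ^ n) in Hg.
assert (H1 := is_series_shift _ _ Hg).
assert (H2 := is_series_shift _ _ H1).
assert (H3 := is_series_shift _ _ H2).
apply (is_series_scal (e1 * y)) in H1.
apply (is_series_scal (e2 * y ^ 2)) in H2.
apply (is_series_scal (e3 * y ^ 3)) in H3.
assert (H := is_series_plus _ _ _ _ (is_series_plus _ _ _ _
               (is_series_plus _ _ _ _ Hg H1) H2) H3).
match type of H with is_series _ ?l =>
  replace ((1 + e1 * y + e2 * y ^ 2 + e3 * y ^ 3) * g) with l end.
2: { change (g + e1 * y * g + e2 * y ^ 2 * g + e3 * y ^ 3 * g
             = (1 + e1 * y + e2 * y ^ 2 + e3 * y ^ 3) * g); ring. }
revert H; apply is_series_ext; intros n.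
change (c n * y ^ n + e1 * y * shift a n + e2 * y ^ 2 * shift (shift a) n
        + e3 * y ^ 3 * shift (shift (shift a)) n = c n * x ^ n).
assert (Hx : c n * x ^ n = c n * y ^ n + c n * (1 - q ^ n) * x ^ n).
{ unfold y; rewrite Cpow_mult_l; ring. }
rewrite Hx, (Hc n).
unfold a, y; destruct n as [|[|[|n]]]; simpl shift;
  rewrite ?Cpow_mult_l, ?Cpow_S; ring.
Qed.

Lemma one_minus_pow_ge (q : C) (n : nat) :
  (Cmod q < 1)%R -> (1 - Cmod q <= Cmod (1 - q ^ S n))%R.
Proof.
intros Hq.
assert (H := Cmod_triangle (1 - q ^ S n) (q ^ S n)).
replace (1 - q ^ S n + q ^ S n) with (RtoC 1) in H by ring.
rewrite Cmod_1, Cmod_pow in H; simpl in H.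
assert (Hp : (Cmod q ^ n <= 1)%R).
{ rewrite <- (pow1 n); apply pow_incr; generalize (Cmod_ge_0 q); lra. }
assert (Hq0 := Cmod_ge_0 q).
simpl Cpow; nra.
Qed.

Lemma one_minus_pow_neq_0 (q : C) (n : nat) :
  (Cmod q < 1)%R -> 1 - q ^ S n <> 0.
Proof.
intros Hq H; generalize (one_minus_pow_ge q n Hq); rewrite H, Cmod_0; lra.
Qed.

Lemma satisfies_summable (e1 e2 e3 q : C) (c : nat -> C) :
  (Cmod q < 1)%R -> satisfies e1 e2 e3 q c ->
  ex_series (fun n => Cmod (c n)).
Proof.
intros Hq Hc; set (r := Cmod q) in *.
assert (Hr : (0 <= r)%R) by apply Cmod_ge_0.
set (E := (Cmod e1 + Cmod e2 + Cmod e3)%R).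
assert (H1 := Cmod_ge_0 e1); assert (H2 := Cmod_ge_0 e2).
assert (H3 := Cmod_ge_0 e3).
assert (HE : (0 <= E / (1 - r))%R).
{ apply Rmult_le_pos; [unfold E; lra | left; apply Rinv_0_lt_compat; lra]. }
apply (geometric_recurrence_summable _ (E / (1 - r)) r); auto.
{ intros n; apply Cmod_ge_0. }
intros n.
assert (Hn := f_equal Cmod (Hc (3 + n)%nat)).
rewrite !Cmod_mult, Cmod_pow in Hn; fold r in Hn; simpl shift in Hn.
assert (Hd := one_minus_pow_ge q (2 + n) Hq); fold r in Hd.
change (S (2 + n)) with (3 + n)%nat in Hd.
set (s := (Cmod (c n) + Cmod (c (1 + n)%nat) + Cmod (c (2 + n)%nat))%R).
assert (H0n := Cmod_ge_0 (c n)); assert (H1n := Cmod_ge_0 (c (1 + n)%nat)).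
assert (H2n := Cmod_ge_0 (c (2 + n)%nat)).
assert (Hs : (Cmod (e1 * c (S (S n)) + e2 * c (S n) + e3 * c n) <= E * s)%R).
{ eapply Rle_trans; [apply Cmod_triangle|].
  eapply Rle_trans; [apply Rplus_le_compat_r, Cmod_triangle|].
  rewrite !Cmod_mult; unfold E, s.
  generalize (Rmult_le_pos _ _ H1 H0n) (Rmult_le_pos _ _ H1 H1n)
    (Rmult_le_pos _ _ H2 H0n) (Rmult_le_pos _ _ H2 H2n)
    (Rmult_le_pos _ _ H3 H1n) (Rmult_le_pos _ _ H3 H2n); simpl; lra. }
assert (Hpow : (r ^ (3 + n) <= r ^ n)%R).
{ simpl; generalize (pow_le r n Hr); intros Hp.
  assert (r * r ^ n <= r ^ n)%R by nra.
  assert (0 <= r * r ^ n)%R by nra.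
  assert (r * (r * r ^ n) <= r * r ^ n)%R by nra.
  assert (0 <= r * (r * r ^ n))%R by nra.
  nra. }
assert (Hpn := pow_le r (3 + n) Hr).
apply Rmult_le_reg_r with (1 - r)%R; [lra|].
replace (E / (1 - r) * r ^ n * s * (1 - r))%R with (r ^ n * (E * s))%R
  by (field; lra).
apply Rle_trans with (Cmod (c (3 + n)%nat) * Cmod (1 - q ^ (3 + n)))%R.
{ apply Rmult_le_compat_l; [apply Cmod_ge_0 | exact Hd]. }
rewrite Hn; apply Rmult_le_compat; auto; apply Cmod_ge_0.
Qed.

(** * Passage to the limit *)

Lemma Cmod_le_sum (a : nat -> C) (l : C) (M : R) :
  is_series a l -> (forall N, sum_n (fun n => Cmod (a n)) N <= M)%R ->
  (Cmod l <= M)%R.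
Proof.
intros Ha HM.
apply (is_lim_seq_le (fun N => Cmod (sum_n a N)) (fun _ => M) (Cmod l) M).
- intros N; eapply Rle_trans; [| apply (HM N)].
  apply (norm_sum_n_m a 0 N).
- unfold is_lim_seq; simpl.
  apply (filterlim_comp _ _ _ (sum_n a) Cmod eventually (locally l)); [exact Ha|].
  apply (filterlim_norm (V := C_NormedModule) l).
- apply is_lim_seq_const.
Qed.

(** Every term but the first carries a factor [x]. *)
Lemma power_series_near_0 (c : nat -> C) (x g : C) :
  ex_series (fun n => Cmod (c n)) -> (Cmod x <= 1)%R ->
  is_series (fun n => c n * x ^ n) g ->
  (Cmod (g - c 0%nat) <= Cmod x * Series (fun n => Cmod (c n)))%R.
Proof.
intros Hc Hx Hg.
assert (Hx0 := Cmod_ge_0 x).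
assert (H : is_series (fun n => c (S n) * x ^ S n) (g - c 0%nat)).
{ apply (is_series_incr_1 (fun n => c n * x ^ n)).
  match goal with |- is_series _ ?t => replace t with g end; [exact Hg|].
  change (g = g - c 0%nat + c 0%nat * 1); ring. }
apply (Cmod_le_sum _ _ _ H); intros N.
assert (Hinc : ex_series (fun n => Cmod (c (S n)))).
{ apply (ex_series_incr_1 (fun n => Cmod (c n))), Hc. }
apply Rle_trans with (sum_n (fun n => Cmod x * Cmod (c (S n)))%R N).
{ apply sum_n_m_le; intros n; rewrite Cmod_mult, Cmod_pow; simpl.
  assert (Hp : (Cmod x ^ n <= 1)%R) by (rewrite <- (pow1 n); apply pow_incr; lra).
  assert (Hcn := Cmod_ge_0 (c (S n))).
  assert (0 <= Cmod x * Cmod (c (S n)))%R by nra.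
  nra. }
rewrite (sum_n_mult_l (K := R_Ring)).
apply (Rmult_le_compat_l (Cmod x)); [exact Hx0|].
rewrite (Series_incr_1 _ Hc).
assert (Hpart : (sum_n (fun n => Cmod (c (S n))) N
                 <= Series (fun n => Cmod (c (S n))))%R).
{ apply (is_lim_seq_incr_compare (sum_n (fun n => Cmod (c (S n))))).
  - exact (Series_correct _ Hinc).
  - intros n; rewrite sum_Sn.
    rewrite <- (Rplus_0_r (sum_n _ n)) at 1.
    apply Rplus_le_compat_l, Cmod_ge_0. }
apply Rle_trans with (1 := Hpart).
generalize (Cmod_ge_0 (c 0%nat)); lra.
Qed.

(** With [G x = sum_n c n x^n], the functional equation gives
    [G 1 = Cprod f N * G (q^N)] for every [N], and [G (q^N)] tends to [c 0 = 1];
    the limit of the partial products is therefore [G 1]. *)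
Theorem product_eq_series (e1 e2 e3 q : C) (c : nat -> C) :
  (Cmod q < 1)%R -> satisfies e1 e2 e3 q c -> c 0%nat = 1 ->
  exists L,
    is_Cinfprod (fun m => 1 + e1 * q ^ m + e2 * (q ^ m) ^ 2 + e3 * (q ^ m) ^ 3) L
    /\ is_series c L.
Proof.
intros Hq Hc Hc0.
set (f := fun m => 1 + e1 * q ^ m + e2 * (q ^ m) ^ 2 + e3 * (q ^ m) ^ 3).
assert (Hsum := satisfies_summable _ _ _ _ _ Hq Hc).
assert (Hq0 := Cmod_ge_0 q).
assert (Hqn : forall n, (Cmod (q ^ n) <= 1)%R).
{ intros n; rewrite Cmod_pow, <- (pow1 n); apply pow_incr; lra. }
assert (Hex : forall N, exists g : C, is_series (fun n => c n * (q ^ N) ^ n) g).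
{ intros N; apply (ex_series_le (V := C_CompleteNormedModule) _ (fun n => Cmod (c n)));
    [| exact Hsum].
  intros n; change (norm (c n * (q ^ N) ^ n)) with (Cmod (c n * (q ^ N) ^ n)).
  rewrite <- Cpow_mult_r, Cmod_mult.
  generalize (Cmod_ge_0 (c n)) (Hqn (N * n)%nat); nra. }
assert (Hiter : forall N (g : C), is_series (fun n => c n * (q ^ N) ^ n) g ->
                is_series c (Cprod f N * g)).
{ induction N as [|N IH]; intros g Hg.
  - simpl Cprod; rewrite Cmult_1_l.
    revert Hg; apply is_series_ext; intros n.
    change (c n * 1 ^ n = c n); rewrite Cpow_1_l; ring.
  - rewrite Cpow_S in Hg; apply (functional_equation e1 e2 e3) in Hg; [|exact Hc].
    rewrite <- Cpow_S in Hg; apply IH in Hg.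
    simpl Cprod; unfold f at 2; rewrite <- Cmult_assoc; exact Hg. }
destruct (Hex 0%nat) as [L HL].
assert (HcL : is_series c (1 * L)) by exact (Hiter 0%nat L HL).
rewrite Cmult_1_l in HcL.
exists L; split; [|exact HcL].
set (A := Series (fun n => Cmod (c n))).
assert (HA : (0 <= A)%R).
{ apply Rle_trans with (Cmod (L - c 0%nat)); [apply Cmod_ge_0|].
  generalize (power_series_near_0 c 1 L Hsum); rewrite Cmod_1, Rmult_1_l.
  intros H; apply H; [lra | exact HL]. }
(* With [|G (q^N) - 1| <= 1/2], the partial product is at most [2 |L|], so its
   distance [|partial product| * |G (q^N) - 1|] to [L] tends to 0. *)
assert (Hclose : forall N, (Cmod q ^ N * A <= / 2)%R ->
          (Cmod (Cprod f N - L) <= 2 * Cmod L * (Cmod q ^ N * A))%R).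
{ intros N HN; destruct (Hex N) as [g Hg].
  assert (Hg1 := power_series_near_0 _ _ _ Hsum (Hqn N) Hg).
  rewrite Cmod_pow, Hc0 in Hg1; fold A in Hg1.
  assert (HLg : L = Cprod f N * g).
  { exact (filterlim_locally_unique (V := C_NormedModule) (F := eventually)
             (sum_n c) _ _ HcL (Hiter N g Hg)). }
  assert (Hghalf : (/ 2 <= Cmod g)%R).
  { assert (H := Cmod_triangle g (- (g - 1))).
    rewrite Cmod_opp in H; replace (g + - (g - 1)) with (RtoC 1) in H by ring.
    rewrite Cmod_1 in H; lra. }
  assert (HP0 := Cmod_ge_0 (Cprod f N)).
  replace (Cprod f N - L) with (Cprod f N * - (g - 1)) by (rewrite HLg; ring).
  rewrite Cmod_mult, Cmod_opp.
  assert (HPL : (Cmod (Cprod f N) <= 2 * Cmod L)%R).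
  { rewrite HLg, Cmod_mult; nra. }
  apply Rmult_le_compat; auto; apply Cmod_ge_0. }
unfold is_Cinfprod.
apply (filterlim_locally_ball_norm (U := C_NormedModule)); intros eps.
set (d := Rmin (/ 2) (eps / (2 * Cmod L + 1))).
assert (HL0 := Cmod_ge_0 L).
assert (Heps := cond_pos eps).
assert (Hd : (0 < d)%R).
{ apply Rmin_pos; [lra | apply Rdiv_lt_0_compat; lra]. }
assert (Hlim : is_lim_seq (fun N => Cmod q ^ N * A)%R 0%R).
{ replace (Finite 0) with (Rbar_mult 0 A) by (simpl; f_equal; ring).
  apply is_lim_seq_scal_r, is_lim_seq_geom; rewrite Rabs_pos_eq; lra. }
apply is_lim_seq_spec in Hlim.
destruct (Hlim (mkposreal d Hd)) as [N0 HN0]; exists N0; intros N HN.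
specialize (HN0 N HN); simpl in HN0.
apply Rabs_def2 in HN0; destruct HN0 as [Hlt _]; rewrite Rminus_0_r in Hlt.
assert (Hd1 := Rmin_l (/ 2) (eps / (2 * Cmod L + 1))); fold d in Hd1.
assert (Hd2 := Rmin_r (/ 2) (eps / (2 * Cmod L + 1))); fold d in Hd2.
apply Rle_lt_trans with (2 * Cmod L * (Cmod q ^ N * A))%R; [apply Hclose; lra|].
assert (Hp : (0 <= Cmod q ^ N * A)%R).
{ apply Rmult_le_pos; [apply pow_le, Hq0 | exact HA]. }
apply Rle_lt_trans with ((2 * Cmod L + 1) * (Cmod q ^ N * A))%R; [nra|].
apply Rlt_le_trans with ((2 * Cmod L + 1) * (eps / (2 * Cmod L + 1)))%R.
- apply Rmult_lt_compat_l; lra.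
- right; field; lra.
Qed.

(** * The terms built from [P] *)

Lemma Cprod_one_minus_pow_neq_0 (q : C) (n : nat) :
  (Cmod q < 1)%R -> Cprod (fun k => 1 - q ^ k) n <> 0.
Proof.
intros Hq; induction n as [|n IH]; simpl Cprod.
- apply C1_nz.
- apply Cmult_neq_0; [exact IH | apply one_minus_pow_neq_0, Hq].
Qed.

(** The factors [1 - q^(m-1)] and [1 - q^(m-2)] in the definition of [P] are
    what clearing the denominators of the terms [m-2] and [m-3] produces. *)
Lemma term_satisfies (z1 z2 z3 q : C) :
  (Cmod q < 1)%R ->
  satisfies (z1 + z2 + z3) (z1 * z2 + z2 * z3 + z3 * z1) (z1 * z2 * z3) q
    (fun m => q ^ m * P z1 z2 z3 q m / Cprod (fun k => 1 - q ^ k) m).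
Proof.
intros Hq n.
assert (Hnz := fun n => one_minus_pow_neq_0 q n Hq).
destruct n as [|[|[|n]]].
- simpl; field; apply C1_nz.
- generalize (Hnz 0%nat); simpl; rewrite !Cmult_1_r; intros H0; field; exact H0.
- generalize (Hnz 0%nat) (Hnz 1%nat); simpl; rewrite !Cmult_1_r.
  intros H0 H1; field; auto.
- assert (HC := Cprod_one_minus_pow_neq_0 q n Hq).
  assert (H0 := Hnz n); assert (H1 := Hnz (S n)); assert (H2 := Hnz (S (S n))).
  unfold shift.
  replace (P z1 z2 z3 q (S (S (S n)))) with
    (q ^ n * ((z1 + z2 + z3) * q ^ 2 * P z1 z2 z3 q (S (S n))
       + (z1 * z2 + z2 * z3 + z3 * z1) * q * (1 - q ^ S (S n)) * P z1 z2 z3 q (S n)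
       + z1 * z2 * z3 * (1 - q ^ S n) * (1 - q ^ S (S n)) * P z1 z2 z3 q n)).
  (* The exponent [m - 3] in the definition of [P] reduces to [n - 0], which is
     not convertible to [n]. *)
  2: { rewrite <- (Nat.sub_0_r n) at 1; reflexivity. }
  generalize (P z1 z2 z3 q (S (S n))) (P z1 z2 z3 q (S n)) (P z1 z2 z3 q n).
  intros p2 p1 p0; simpl Cprod; rewrite !Cpow_S in *.
  field; auto.
Qed.

Theorem theorem6p2 :
  forall z1 z2 z3 q : C,
    (Cmod q < 1)%R ->
    exists L : C,
      is_Cinfprod
        (fun m : nat => (1 + z1 * q ^ m) * (1 + z2 * q ^ m) * (1 + z3 * q ^ m)) L
      /\ is_series
           (fun m : nat =>
              q ^ m * P z1 z2 z3 q m / Cprod (fun k : nat => 1 - q ^ k) m) L.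
Proof.
intros z1 z2 z3 q Hq.
destruct (product_eq_series _ _ _ q _ Hq (term_satisfies z1 z2 z3 q Hq))
  as [L [Hprod Hseries]].
{ simpl; field; apply C1_nz. }
exists L; split; [|exact Hseries].
revert Hprod; apply filterlim_ext; intros N.
induction N as [|N IH]; simpl Cprod; [reflexivity|].
apply f_equal2; [exact IH | ring].
Qed.
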